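(* Let $m\ge 3$ be an integer and put $g=\varphi(m)$, where $\varphi$ is Euler's totient function. Then $$V_g\ \ge\ \frac{m}{4^g}.$$
   Context: Let $(A;L)$ be a principally polarized complex abelian variety of dimension $g\ge 1$. Put $T_A=\Gamma(A;\Omega_{A/\mathbb{C}})^\vee$ (the dual of the space of global holomorphic 1-forms, i.e. the tangent space at the origin), and let $\Gamma_A\subset T_A$ be the period lattice of $A$, so that $A(\mathbb{C})\simeq T_A/\Gamma_A$ as complex analytic groups. The polarization $L$ induces a Riemann form $\langle\ ;\ \rangle$ on $T_A$, i.e. a (positive definite) Hermitian inner product on $T_A$ such that $\mathrm{Im}\langle\gamma_1;\gamma_2\rangle\in\mathbb{Z}$ for all $(\gamma_1;\gamma_2)\in\Gamma_A^2$. For a lattice $\Gamma$ of an $n$-dimensional Euclidean space, $\lambda_1(\Gamma)=\min_{\gamma\in\Gamma\setminus\{0\}}\|\gamma\|$ is its first minimum, and its packing density $\Delta(\Gamma)$ is the density of the packing by balls of radius $\lambda_1(\Gamma)/2$ centred at the points of $\Gamma$. If $\Gamma$ has covolume 1, then $\Delta(\Gamma)=\frac{v_n}{2^n}\lambda_1(\Gamma)^n$, where $v_n$ is the volume of the unit ball of $\mathbb{R}^n$. The injectivity volume $V(A;L)$ is the packing density of the lattice $\Gamma_A$ in the Euclidean space $(T_A;\mathrm{Re}\langle\ ;\ \rangle)$, of real dimension $2g$. Equivalently, it is the largest volume of an open ball of $T_A$ that injects into $A$, with volume normalized so that $\Gamma_A$ has covolume 1. For an integer $g\ge1$, $V_g=\sup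 V(A;L)$, the supremum being over all principally polarized complex abelian varieties $(A;L)$ of dimension $g$. *)

(* Defs.v *)
From HB Require Import structures.
From mathcomp Require Import all_boot all_order all_algebra sesquilinear.
From mathcomp Require Import complex.
From mathcomp Require Import all_classical all_reals all_analysis.

Set Implicit Arguments.
Unset Strict Implicit.
Unset Printing Implicit Defensive.

Import Order.TTheory GRing.Theory Num.Theory.
Import numFieldNormedType.Exports.

Local Open Scope classical_set_scope.
Local Open Scope ring_scope.

(* Lebesgue measure on R^n as the iterated product of the measure on R: the
   successor case is the library's formula [product_measure1] for the measure
   of A as the integral of the measures of its sections. It is meaningful for
   Borel sets A. *)
Fixpoint lebesgue_tuple (R : realType) (n : nat) :
    set (n.-tuple R) -> \bar R :=
  match n with
  | 0 => fun A => \d_([tuple]) A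
  | n'.+1 => fun A =>
      (\int[lebesgue_measure]_x
         lebesgue_tuple [set t : n'.-tuple R | A [tuple of x :: t]])%E
  end.

Definition unit_ball_volume (R : realType) (n : nat) : R :=
  fine (lebesgue_tuple [set t : n.-tuple R | \sum_(x <- t) x ^+ 2 < 1]).

Section EuclideanLattice.
Context {R : realType} {T : zmodType} {n : nat}.
Variables (dot : T -> T -> R) (b : 'I_n -> T).

Definition lattice : set T :=
  [set \sum_i b i *~ z i | z in [set: 'I_n -> int]].

Definition first_minimum : R :=
  inf [set Num.sqrt (dot x x) | x in lattice `\ 0].

Definition covolume : R :=
  Num.sqrt (\det (\matrix_(i < n, j < n) dot (b i) (b j))).

(* The density of a lattice packing: the volume of one ball, divided by the
   volume of a fundamental domain. *)
Definition packing_density : R :=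
  unit_ball_volume R n * (first_minimum / 2) ^+ n / covolume.

End EuclideanLattice.

(* A principally polarized complex abelian variety of dimension g, given
   analytically: the torus [tangent / lattice periods] together with the
   Hermitian form (linear in the first variable) of its polarization. By the
   theorems of Appell-Humbert and Lefschetz, such a form on a torus is the same
   thing as a polarization, and makes the torus algebraic. *)
Record ppav (R : realType) (g : nat) := Ppav {
  tangent : vectType R[i];
  tangent_dim : \dim {: tangent} = g;
  periods : 'I_(2 * g) -> tangent;
  (* The periods are linearly independent over the reals, hence a real basis. *)
  periods_free : forall c : 'I_(2 * g) -> R,
    \sum_i (c i)%:C%C *: periods i = 0 -> forall i, c i = 0;
  riemann : {dot tangent for Num.conj};
  riemann_int : forall x y : tangent, lattice periods x -> lattice periods y ->
    complex.Im (riemann x y) \is a Num.int;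
  (* The kernel of the isogeny from the torus to its dual induced by the
     polarization is the quotient by the lattice of its dual lattice for the
     form Im; the polarization is principal when this kernel is trivial. *)
  riemann_principal : forall x : tangent,
    (forall y : tangent, lattice periods y ->
       complex.Im (riemann x y) \is a Num.int) ->
    lattice periods x
}.

Definition injectivity_volume (R : realType) (g : nat) (A : ppav R g) : R :=
  packing_density (fun x y => complex.Re (riemann A x y)) (@periods _ _ A).

Definition sup_injectivity_volume (R : realType) (g : nat) : \bar R :=
  ereal_sup [set v | exists A : ppav R g, v = (injectivity_volume A)%:E].

(* Main.v *)
(* The lattices are [Z^g + (X + i Y) Z^g], where the Hermitian form has matrix
   [Y^-1]; the squared length of the vector with coordinates [(u, n)] is
   [qform Y^-1 (u + X n) + qform Y n]. Let [C] be an integral matrix of order m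
   with characteristic polynomial Phi_m. If [C X = X C^T] and [C Y C^T = Y], then
   [(u, n) |-> (C u, C^T n)] is an isometry of the lattice (although not a
   complex linear one), so the nonzero short vectors come in orbits of length m.
   The matrices [X = N^-1 sum_k a_k S_k], with integral symmetric [S_k]
   intertwining [C] and [C^T], are indexed by [a] in [(Z/N)^g]. For N prime and
   large, [(a, u, n) |-> (N (u + X n), n)] is injective on the short vectors with
   [n <> 0]. Hence, if every [a] gave a nonzero vector shorter than r, some
   ellipsoid would contain [m N^g] points of [Z^2g]; comparing with its volume,
   when [Y] is small and N is large, bounds m by the volume of the ball of
   radius r. *)

Require Import Defs.
From mathcomp Require Import all_boot all_order all_algebra all_field.
From mathcomp Require Import sesquilinear spectral complex.
From mathcomp Require Import all_classical all_reals all_analysis.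
From mathcomp Require Import measurable_realfun.
From mathcomp Require Import zify ring lra.

Set Implicit Arguments.
Unset Strict Implicit.
Unset Printing Implicit Defensive.

Import Order.TTheory GRing.Theory Num.Theory.

Local Open Scope classical_set_scope.
Local Open Scope ring_scope.

(** * Volumes of balls *)

Section BallVolume.
Variable R : realType.
Notation mu := (@lebesgue_measure R).

(** The parameter [q] is the squared radius, of any sign: the slice at [x] of a ball is then the
    ball of parameter [q - x ^+ 2], empty when this is nonpositive. *)
Definition ball_volume (n : nat) (q : R) : R :=
  fine (lebesgue_tuple [set t : n.-tuple R | \sum_(x <- t) x ^+ 2 < q]).

Lemma ball_volume_unit n : ball_volume n 1 = unit_ball_volume R n.
Proof. by []. Qed.

Lemma lebesgue_tuple_ballS n (q : R) :
  lebesgue_tuple [set t : n.+1.-tuple R | \sum_(x <- t) x ^+ 2 < q] =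
  (\int[mu]_x
    lebesgue_tuple [set t : n.-tuple R | (\sum_(y <- t) y ^+ 2 < q - x ^+ 2)%R])%E.
Proof.
apply: eq_integral => x _ /=; congr lebesgue_tuple.
by apply/seteqP; split => t /=; rewrite big_cons /= ltrBrDl.
Qed.

Let measurable_slice (w : R -> R) (q : R) : {homo w : x y / x <= y} ->
  measurable_fun [set: R] (EFin \o (fun x : R => w (q - x ^+ 2))).
Proof.
move=> w_mono; apply/measurable_EFinP.
apply: (@measurableT_comp _ _ _ _ _ _ w); first exact: nondecreasing_measurable.
by apply: measurable_funB => //; apply: measurable_funX.
Qed.

(** The claims need a joint induction: monotonicity makes the slice volumes measurable, vanishing
    for [q <= 0] bounds their support, and both together make the integral finite, so that [fine]
    loses nothing. *)
Let ballP n : [/\ forall q, lebesgue_tuple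
      [set t : n.-tuple R | \sum_(x <- t) x ^+ 2 < q] = (ball_volume n q)%:E,
    {homo ball_volume n : x y / x <= y} & forall q, q <= 0 -> ball_volume n q = 0].
Proof.
elim: n => [|n [ballE ball_mono ball0]].
  have E q : lebesgue_tuple [set t : 0.-tuple R | \sum_(x <- t) x ^+ 2 < q]
      = (0 < q)%R%:R%:E.
    rewrite /= diracE; congr ((_ : bool)%:R%:E).
    by apply/idP/idP; rewrite in_setE /= big_nil.
  split.
  - by move=> q; rewrite /ball_volume E.
  - move=> p q pq; rewrite /ball_volume !E /= ler_nat.
    by case: (ltP 0 p) => // /lt_le_trans ->.
  - by move=> q q0; rewrite /ball_volume E ltNge q0.
have ge0 q : 0 <= ball_volume n q.
  have [/ball0 -> //|q0] := leP q 0.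
  by rewrite -(ball0 0 (lexx _)); apply/ball_mono/ltW.
have E q : lebesgue_tuple [set t : n.+1.-tuple R | \sum_(x <- t) x ^+ 2 < q] =
    (\int[mu]_x (ball_volume n (q - x ^+ 2))%:E)%E.
  by rewrite lebesgue_tuple_ballS; under eq_integral do rewrite ballE.
have mono p q : p <= q ->
   (\int[mu]_x (ball_volume n (p - x ^+ 2))%:E <=
    \int[mu]_x (ball_volume n (q - x ^+ 2))%:E)%E.
  move=> pq; apply: ge0_le_integral => //; try exact: measurable_slice.
  all: try by move=> x _; rewrite lee_fin.
  by move=> x _; rewrite lee_fin ball_mono // lerD2r.
have fin q : (\int[mu]_x (ball_volume n (q - x ^+ 2))%:E)%E \is a fin_num.
  rewrite ge0_fin_numE; last by apply: integral_ge0 => x _; rewrite lee_fin.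
  (* Since [c >= 1], [|x| > c] implies [x ^+ 2 > c >= q]: the slices outside [[-c, c]] are empty. *)
  set c := `|q| + 1.
  have c1 : 1 <= c by rewrite /c lerDr.
  apply: (@le_lt_trans _ _ (\int[mu]_x ((ball_volume n q)%:E *
     (\1_(`[- c, c]%classic : set R) x)%:E))%E).
    apply: ge0_le_integral => //; try exact: measurable_slice.
    all: try by move=> x _; rewrite lee_fin ?mulr_ge0.
      by apply: measurable_funeM; apply/measurable_EFinP; exact: measurable_indic.
    move=> x _; rewrite lee_fin indicE.
    case: (boolP (x \in _)) => [_|].
      by rewrite mulr1 ball_mono // lerBlDr lerDl sqr_ge0.
    move=> /negP; rewrite in_setE /= in_itv /= -ler_norml => xc.
    rewrite mulr0 ball0 //.
    have qc : q <= c by rewrite (le_trans (ler_norm q)) // lerDl.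
    have {xc} : c < `|x| by rewrite ltNge; apply/negP.
    by rewrite -[x ^+ 2]real_normK ?num_real //; nra.
  rewrite ge0_integralZl_EFin //; last first.
    by apply/measurable_EFinP; exact: measurable_indic.
  rewrite integral_indic // setIT.
  rewrite [X in (_ * X)%E](lebesgue_measure_itv `[- c, c]) /=.
  by case: ifP => _; rewrite ?mule0 ?ltry // -EFinD -EFinM ltry.
split.
- by move=> q; rewrite /ball_volume E fineK.
- by move=> p q pq; rewrite /ball_volume !E fine_le // mono.
- move=> q q0; rewrite /ball_volume E integral0_eq // => x _.
  by rewrite ball0 // subr_le0 (le_trans q0) // sqr_ge0.
Qed.

Lemma ball_volume_mono n : {homo ball_volume n : x y / x <= y}.
Proof. by have [] := ballP n. Qed.

Lemma ball_volume_ge0 n q : 0 <= ball_volume n q.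
Proof.
have [_ mono ball0] := ballP n.
have [/ball0 -> //|q0] := leP q 0.
by rewrite -(ball0 0 (lexx _)); apply/mono/ltW.
Qed.

Lemma ball_volumeS n q :
  (ball_volume n.+1 q)%:E = (\int[mu]_x (ball_volume n (q - x ^+ 2))%:E)%E.
Proof.
have [<- _ _] := ballP n.+1; rewrite lebesgue_tuple_ballS.
by apply: eq_integral => x _; have [-> _ _] := ballP n.
Qed.

(* Cavalieri for a comparison with disjoint slabs of thickness [t]. *)
Lemma sum_le_ball_volumeS n (q t c : R) (s : seq int) (a : int -> R) :
    0 < t -> uniq s -> {in s, forall k, 0 <= a k} ->
    (forall k x, k \in s -> t * k%:~R + c <= x < t * k%:~R + c + t ->
      a k <= ball_volume n (q - x ^+ 2)) ->
  (\sum_(k <- s) a k) * t <= ball_volume n.+1 q.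
Proof.
move=> t0 us a0 le_a; rewrite -lee_fin ball_volumeS.
pose I (k : int) : set R := `[t * k%:~R + c, t * k%:~R + c + t[%classic.
have mI k : measurable (I k) by apply: measurable_itv.
have mf D : measurable D -> measurable_fun D
    (EFin \o (fun x : R => ball_volume n (q - x ^+ 2))).
  move=> mD; apply: (measurable_funS measurableT) => //.
  exact: measurable_slice (@ball_volume_mono n).
have f0 x : (0 <= (ball_volume n (q - x ^+ 2))%:E)%E.
  by rewrite lee_fin ball_volume_ge0.
pose D := \big[setU/set0]_(k <- s) I k.
have mD : measurable D by apply: bigsetU_measurable.
apply: (@le_trans _ _ (\int[mu]_(x in D) (ball_volume n (q - x ^+ 2))%:E)%E); last first.
  by apply: ge0_subset_integral => //; apply: mf.
have trivI : trivIset [set` s] I.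
  apply/trivIsetP => j k _ _ jk; apply/seteqP; split => // x [] /=.
  rewrite /I /= !in_itv /= => /andP[j1 j2] /andP[k1 k2].
  move: jk; rewrite neq_lt => /orP[] jk.
    have : t * (j%:~R + 1) <= t * k%:~R.
      by rewrite ler_pM2l // -[1]/(1%:~R) -intrD ler_int lezD1.
    lra.
  have : t * (k%:~R + 1) <= t * j%:~R.
    by rewrite ler_pM2l // -[1]/(1%:~R) -intrD ler_int lezD1.
  lra.
rewrite ge0_integral_bigsetU //; last exact: mf.
rewrite mulr_suml -sumEFin !big_seq; apply: lee_sum => k ks.
have -> : (a k * t)%:E = (\int[mu]_(x in I k) (a k)%:E)%E.
  rewrite integral_cst; last exact: mI.
  rewrite [X in (_ * X)%E](lebesgue_measure_itv
    `[t * k%:~R + c, t * k%:~R + c + t[) /= lte_fin ltrDl t0.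
  by rewrite -EFinB -EFinM; congr (_ %:E); ring.
apply: ge0_le_integral => //.
- exact: mI.
- by move=> x _; rewrite lee_fin a0.
- exact: mf.
- by move=> x; rewrite /I /= in_itv /= lee_fin; apply: le_a.
Qed.

End BallVolume.

(** * Counting integral points of an ellipsoid *)

Definition qform (R : pzRingType) n (G : 'M[R]_n) (x : 'cV[R]_n) : R :=
  (x^T *m G *m x) 0 0.

Definition posdef (R : numDomainType) n (G : 'M[R]_n) : Prop :=
  G^T = G /\ forall x, x != 0 -> 0 < qform G x.

Definition sqnorm (R : pzRingType) n (x : 'cV[R]_n) : R := \sum_i x i 0 ^+ 2.

Lemma sqnormE (R : pzRingType) n (x : 'cV[R]_n) : sqnorm x = (x^T *m x) 0 0.
Proof. by rewrite mxE; apply: eq_bigr => i _; rewrite mxE expr2. Qed.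

Lemma sqnorm_ge0 (R : realDomainType) n (x : 'cV[R]_n) : 0 <= sqnorm x.
Proof. by apply: sumr_ge0 => i _; apply: sqr_ge0. Qed.

Lemma sqnorm_gt0 (R : realDomainType) n (x : 'cV[R]_n) : x != 0 -> 0 < sqnorm x.
Proof.
move=> x0; rewrite lt_def sqnorm_ge0 andbT; apply: contraNneq x0 => /eqP.
rewrite psumr_eq0 => [/allP x0|i _]; last exact: sqr_ge0.
apply/eqP/colP => i; have := x0 i (mem_index_enum _).
by rewrite sqrf_eq0 mxE => /eqP.
Qed.

(** Induction on the lower right block. With [M] lower triangular, the first coordinate of [M z]
    depends only on that of [z], which is what slicing in [count_trig] requires. *)
Lemma cholesky (R : rcfType) n (G : 'M[R]_n) : posdef G ->
  exists M : 'M[R]_n,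
    [/\ is_trig_mx M, forall i, 0 < M i i & G = M^T *m M].
Proof.
elim: n G => [|n IHn] G.
  move=> _; exists 0; split; [exact: mx0_is_trig | by case | ].
  by apply/matrixP => -[].
move: G; rewrite -[n.+1]/(1 + n)%N => G [Gsym Gpos].
set G' := drsubmx G; set b := dlsubmx G; set a := G 0 0.
have Gb : G = block_mx a%:M b^T b G'.
  rewrite -[LHS]submxK /b trmx_dlsub Gsym; congr block_mx.
  rewrite [LHS]mx11_scalar; congr (_%:M); rewrite !mxE; congr (G _ _); exact/val_inj.
have [|M' [M'trig M'pos EG']] := IHn G'.
  split; first by rewrite /G' trmx_drsub Gsym.
  move=> x x0; have := Gpos (col_mx 0 x); rewrite /qform.
  rewrite {1}Gb tr_col_mx trmx0 mul_row_block mul_row_col.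
  rewrite !mul0mx !mulmx0 !add0r; apply.
  by apply: contra x0 => /eqP; rewrite -(col_mx0 R 1 n 1) => /eq_col_mx[_ ->].
have M'unit : M' \in unitmx.
  rewrite unitmxE det_trig // unitfE; apply/prodf_neq0 => i _.
  exact: lt0r_neq0.
pose p := (invmx M')^T *m b.
have Ep : M'^T *m p = b by rewrite /p mulmxA -trmx_mul mulVmx // trmx1 mul1mx.
have tpos : 0 < a - sqnorm p.
  (* The vector [(1, y)] minimizes the form among those with first coordinate 1; its value is the
     Schur complement [a - sqnorm p]. *)
  pose y := - (invmx M' *m p).
  have My : M' *m y = - p by rewrite mulmxN mulKVmx.
  have bp : b^T = p^T *m M' by rewrite -Ep trmx_mul trmxK.
  have := Gpos (col_mx 1%:M y); rewrite /qform.
  rewrite {1}Gb tr_col_mx mul_row_block mul_row_col trmx1 !mul1mx mulmx1.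
  rewrite EG' bp -Ep.
  have -> : y^T *m (M'^T *m p) = - (p^T *m p).
    by rewrite mulmxA -trmx_mul My linearN mulNmx.
  have -> : (p^T *m M' + y^T *m (M'^T *m M')) *m y = 0.
    rewrite mulmxDl -!mulmxA My !mulmxA -trmx_mul My.
    by rewrite !linearN /= mulNmx opprK addNr.
  rewrite addr0 mxE [X in _ + X]mxE -sqnormE.
  rewrite mxE eqxx mulr1n; apply.
  apply/eqP => /matrixP/(_ (lshift n 0) 0); rewrite col_mxEu !mxE eqxx.
  by move/eqP; rewrite oner_eq0.
exists (block_mx (Num.sqrt (a - sqnorm p))%:M 0 p M'); split.
- apply/is_trig_mxP => i j.
  case: (splitP i) => i' Ei; case: (splitP j) => j' Ej; rewrite ?Ei ?Ej.
  + by rewrite !ord1.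
  + move=> _; have -> : i = lshift n i' by exact/val_inj.
    have -> : j = rshift 1 j' by exact/val_inj.
    by rewrite block_mxEur mxE.
  + by rewrite !ord1 ltn0.
  + rewrite ltn_add2l => lt; have -> : i = rshift 1 i' by exact/val_inj.
    have -> : j = rshift 1 j' by exact/val_inj.
    by rewrite block_mxEdr; apply/is_trig_mxP.
- move=> i; case: (splitP i) => i' Ei.
    have -> : i = lshift n i' by exact/val_inj.
    by rewrite block_mxEul !ord1 mxE eqxx sqrtr_gt0.
  have -> : i = rshift 1 i' by exact/val_inj.
  by rewrite block_mxEdr.
- rewrite tr_block_mx mulmx_block !trmx0 !mul0mx !mulmx0 !add0r -EG' Ep.
  rewrite Gb; congr block_mx; last by rewrite -Ep trmx_mul trmxK.
  rewrite tr_scalar_mx -scalar_mxM -expr2 sqr_sqrtr ?ltW //.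
  by rewrite [p^T *m p]mx11_scalar -sqnormE -raddfD subrK.
Qed.

Section Count.
Variable R : realType.

Notation "z %:cR" := (map_mx intr z : 'cV[R]_ _) (at level 2, format "z %:cR").

(** Each point [M z + c] carries a box with sides [M i i]; these boxes are disjoint and stay in the
    enlarged ball. The volume is compared slice by slice along the first coordinate, and fixing that
    coordinate of [z] translates the others, hence the shift [c]. *)
Lemma count_trig n (M : 'M[R]_n) (c : 'cV[R]_n) (rho : R)
    (s : seq 'cV[int]_n) :
    is_trig_mx M -> (forall i, 0 < M i i) -> uniq s -> 0 <= rho ->
    {in s, forall z : 'cV[int]_n, sqnorm (M *m z%:cR + c) < rho ^+ 2} ->
  (size s)%:R * \prod_i M i i <= ball_volume n ((rho + \sum_i M i i) ^+ 2).
Proof.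
elim: n M c rho s => [|n IHn] M c rho s Mtrig Mpos us rho0 s_lt.
  have [-> |] := eqVneq s [::]; first by rewrite mul0r ball_volume_ge0.
  case: s us s_lt => // z [|z' s] //= us s_lt _; last first.
    by move: us; rewrite (flatmx0 z') (flatmx0 z) mem_head.
  have : sqnorm (M *m z%:cR + c) < rho ^+ 2 by apply: s_lt; rewrite mem_head.
  rewrite /sqnorm !big_ord0 addr0 mulr1 => rho_gt0.
  rewrite /ball_volume /lebesgue_tuple diracE /=.
  by rewrite mem_set //= big_nil.
have lt_trig (i : 'I_n) : M 0 (lift 0 i) = 0 by apply: (is_trig_mxP Mtrig).
pose M' : 'M[R]_n := \matrix_(i, j) M (lift 0 i) (lift 0 j).
pose tl (z : 'cV[int]_n.+1) : 'cV[int]_n := \col_i z (lift 0 i) 0.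
pose hd (z : 'cV[int]_n.+1) : int := z 0 0.
pose c' (k : int) : 'cV[R]_n := \col_i (M (lift 0 i) 0 * k%:~R + c (lift 0 i) 0).
set t := M 0 0; pose y (k : int) := t * k%:~R + c 0 0.
have t0 : 0 < t := Mpos 0.
have normE z : sqnorm (M *m z%:cR + c) =
    y (hd z) ^+ 2 + sqnorm (M' *m (tl z)%:cR + c' (hd z)).
  rewrite /sqnorm big_ord_recl; congr (_ ^+ 2 + _).
    rewrite mxE mxE big_ord_recl big1 => [|i _]; last by rewrite lt_trig mul0r.
    by rewrite addr0 mxE.
  apply: eq_bigr => i _; congr (_ ^+ 2).
  rewrite !mxE big_ord_recl !mxE addrAC [RHS]addrC; congr (_ + _).
       by apply: eq_bigr => j _; rewrite !mxE.
(* The points with first integral coordinate [k] are charged to the slab from [y k] to [y k + t]. *)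
pose sk k := [seq z <- s | hd z == k].
pose hs := undup (map hd s).
have size_s : size s = (\sum_(k <- hs) size (sk k))%N.
  rewrite -(sum1_size s) (eq_big_seq (fun z => \sum_(k <- hs) (hd z == k))%N).
    by rewrite exchange_big; apply: eq_bigr => k _; rewrite size_filter -sum1_count
      [RHS]big_mkcond.
  move=> z zs; rewrite (bigD1_seq (hd z)) ?undup_uniq ?mem_undup ?map_f //=.
  by rewrite eqxx big1 // => k /negPf; rewrite eq_sym => ->.
rewrite size_s natr_sum big_ord_recl /= -/t (mulrC t) mulrA mulr_suml.
have M'pos i : 0 < M' i i by rewrite mxE.
have -> : \prod_(i < n) M (lift ord0 i) (lift ord0 i) = \prod_i M' i i.
  by apply: eq_bigr => i _; rewrite mxE.
rewrite big_ord_recl /=.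
have -> : \sum_(i < n) M (lift ord0 i) (lift ord0 i) = \sum_i M' i i.
  by apply: eq_bigr => i _; rewrite mxE.
have D'0 : 0 <= \sum_i M' i i by apply: sumr_ge0 => i _; apply: ltW.
apply: (sum_le_ball_volumeS (c := c 0 0)) => //; first exact: undup_uniq.
  by move=> k _; rewrite mulr_ge0 // prodr_ge0 // => i _; apply: ltW.
move=> k x; rewrite mem_undup => /mapP[z zs ->] {k} /andP[x1 x2].
rewrite -/(y (hd z)) in x1 x2.
have y_lt : y (hd z) ^+ 2 < rho ^+ 2.
  by apply: le_lt_trans (s_lt z zs); rewrite normE lerDl sqnorm_ge0.
pose rho' := Num.sqrt (rho ^+ 2 - y (hd z) ^+ 2).
have rho'2 : rho' ^+ 2 = rho ^+ 2 - y (hd z) ^+ 2.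
  by rewrite sqr_sqrtr // subr_ge0 ltW.
have rho'0 : 0 <= rho' by apply: sqrtr_ge0.
have inj_tl : {in sk (hd z) &, injective tl}.
  move=> z1 z2; rewrite !mem_filter => /andP[/eqP h1 _] /andP[/eqP h2 _] E.
  apply/colP => i; case: (unliftP 0 i) => [j|] ->.
    by have := congr1 (fun v : 'cV_n => v j 0) E; rewrite !mxE.
  by have : hd z1 = hd z2 by rewrite h1 h2.
have := IHn M' (c' (hd z)) rho' (map tl (sk (hd z))).
rewrite size_map => /(_ _ M'pos _ rho'0 _) IH.
apply: le_trans (IH _ _ _) _.
- apply/is_trig_mxP => i j ij; rewrite mxE; apply: (is_trig_mxP Mtrig).
  by rewrite !lift0.
- by rewrite map_inj_in_uniq // filter_uniq.
- move=> _ /mapP[z1 + ->]; rewrite mem_filter => /andP[/eqP h1 z1s].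
  by rewrite rho'2 ltrBrDl -h1 -normE s_lt.
apply: ball_volume_mono.
(* The goal [(rho' + D)^2 + x^2 <= (rho + t + D)^2] follows from [|x| <= |y| + t],
   [rho'^2 + y^2 = rho^2], and the bounds of [rho'] and [|y|] by [rho]. *)
set D := \sum_i _ in D'0 *.
have rho'_le : rho' <= rho by rewrite leNgt; apply/negP => lt; nra.
have y2 : `|y (hd z)| ^+ 2 = y (hd z) ^+ 2 by rewrite real_normK ?num_real.
have y0 : 0 <= `|y (hd z)| by apply: normr_ge0.
have y_le : `|y (hd z)| <= rho by rewrite leNgt; apply/negP => lt; nra.
have x_le : x ^+ 2 <= (`|y (hd z)| + t) ^+ 2.
  rewrite -[x ^+ 2]real_normK ?num_real // ler_sqr ?nnegrE; last 2 first.
  - by [].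
  - by rewrite addr_ge0 // ltW.
  have := ler_norm (y (hd z)); have := ler_norm (- y (hd z)); rewrite normrN.
  by move=> H1 H2; rewrite ler_norml; apply/andP; split; lra.
have : 0 <= (rho - rho') * D by rewrite mulr_ge0 // subr_ge0.
have : 0 <= (rho - `|y (hd z)|) * t by rewrite mulr_ge0 ?subr_ge0 // ltW.
have : 0 <= t * D by rewrite mulr_ge0 // ltW.
by rewrite -[M ord0 ord0]/t; nra.
Qed.

(* The Cholesky factor identifies the form [G] with the Euclidean norm on a
   triangular lattice, whose cells are boxes with sides at most [sqrt G_ii]. *)
Lemma count_posdef n (G : 'M[R]_n) (rho : R) (s : seq 'cV[int]_n) :
    posdef G -> uniq s -> 0 <= rho ->
    {in s, forall z : 'cV[int]_n, qform G z%:cR < rho ^+ 2} ->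
    rho + \sum_i Num.sqrt (G i i) <= 1 ->
  (size s)%:R * Num.sqrt (\det G) <= unit_ball_volume R n.
Proof.
move=> Gpos us rho0 s_lt le1.
have [M [Mtrig Mpos EG]] := cholesky Gpos.
have -> : Num.sqrt (\det G) = \prod_i M i i.
  rewrite EG det_mulmx det_tr det_trig // -expr2 sqrtr_sqr ger0_norm //.
  by apply: prodr_ge0 => i _; apply: ltW.
have Mle i : M i i <= Num.sqrt (G i i).
  rewrite -[leLHS](ger0_norm (ltW (Mpos i))) -sqrtr_sqr; apply: ler_wsqrtr.
  rewrite EG mxE.
  rewrite (bigD1 i) //= mxE -expr2 lerDl sumr_ge0 // => j _.
  by rewrite mxE -expr2 sqr_ge0.
have := count_trig (c := 0) Mtrig Mpos us rho0 _.
move/(_ _)/le_trans; apply.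
  move=> z /s_lt; rewrite /qform EG addr0 sqnormE trmx_mul.
  by rewrite !mulmxA.
rewrite -ball_volume_unit ball_volume_mono // expr_le1 //.
  by apply: le_trans le1; rewrite lerD2l ler_sum.
by rewrite addr_ge0 // sumr_ge0 // => i _; apply: ltW.
Qed.

End Count.

(** * Integral matrices from the cyclotomic polynomial *)

(** Stated as an existence so that the size is [d] itself and not [(size p).-1]. *)
Lemma companion_mx_exists (R : comNzRingType) (p : {poly R}) (d : nat) :
    p \is monic -> size p = d.+1 ->
  exists2 C : 'M[R]_d, char_poly C = p &
    forall i j : 'I_d, j = i.+1 :> nat ->
      delta_mx 0 i *m C = delta_mx 0 j :> 'rV_d.
Proof.
move=> p_monic /(congr1 predn) /= <-; exists (companionmx p).
  exact: companionmxK.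
move=> i j Eij; have lt_i : (i.+1 < (size p).-1)%N by rewrite -Eij.
rewrite (mulmx_delta_companion lt_i); congr delta_mx.
exact/val_inj.
Qed.

Local Notation pQtoC := (map_poly (ratr : rat -> algC)).
Local Notation pZtoC := (map_poly (intr : int -> algC)).

Lemma char_poly_tr (R : comNzRingType) (d : nat) (A : 'M[R]_d) :
  char_poly A^T = char_poly A.
Proof.
rewrite /char_poly -det_tr; congr (\det _).
by rewrite /char_poly_mx linearB /= tr_scalar_mx map_trmx trmxK.
Qed.

Lemma mulmx_eq0_det (R : idomainType) (d : nat) (M : 'M[R]_d) (w : 'cV_d) :
  \det M != 0 -> M *m w = 0 -> w = 0.
Proof.
move=> detM /(congr1 (mulmx (\adj M))).
rewrite mulmxA mul_adj_mx mulmx0 mul_scalar_mx => /eqP.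
by rewrite scalemx_eq0 (negPf detM) => /eqP.
Qed.

(** * Cyclic vectors when the characteristic polynomial is irreducible over the rationals *)

Section Krylov.
Variables (d : nat) (C : 'M[int]_d.+1) (z : algC).
Hypothesis minC : pZtoC (char_poly C) = minCpoly z.

Let A : 'M[rat]_d.+1 := map_mx intr C.

Let AX k : A ^+ k = map_mx intr (C ^+ k).
Proof. by rewrite /A rmorphXn. Qed.

(** The characteristic polynomial is the minimal polynomial of [z], so a [q] with [q(z) != 0] is
    coprime to it; Bezout and Cayley-Hamilton then provide an inverse of [q(A)]. *)
Lemma horner_mx_unit (q : {poly rat}) :
  ~~ root (pQtoC q) z -> horner_mx A q \in unitmx.
Proof.
have [p [Dp _ dvdp]] := minCpolyP z.
have Ep : char_poly A = p.
  rewrite /A -map_char_poly; apply: (map_poly_inj (@ratr algC)).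
  rewrite -Dp -minC -map_poly_comp.
  by apply: eq_map_poly => x /=; rewrite ratr_int.
(* [z] is a root of the gcd or of its cofactor [e] in [p]. The former would make it a root of [q];
   in the latter case [p] divides [e], and the gcd is constant. *)
move=> nrq; have copq : coprimep p q.
  have dp := dvdp_gcdl p q.
  have [e Dpe] : exists e, p = e * gcdp p q.
    by exists (p %/ gcdp p q); rewrite divpK.
  have : root (pQtoC p) z by rewrite dvdp.
  rewrite {1}Dpe rmorphM rootM !dvdp => /orP[pe|].
    have p0 : p != 0.
      apply: contraNneq (monic_neq0 (char_poly_monic A)) => p0.
      by rewrite Ep p0.
    have e0 : e != 0 by apply: contraNneq p0 => e0; rewrite Dpe e0 mul0r.
    have g0 : gcdp p q != 0.
      by apply: contraNneq p0 => g0; rewrite Dpe g0 mulr0.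
    have := dvdp_leq e0 pe; rewrite {1}Dpe size_mul // /coprimep.
    have : (0 < size e)%N by rewrite size_poly_gt0.
    have : (0 < size (gcdp p q))%N by rewrite size_poly_gt0.
    by case: size => [|[|k]] //; case: size => // l _ _; rewrite !addnS /= ltnNge leq_addr.
  move=> /dvdp_trans/(_ (dvdp_gcdr _ _)); rewrite -dvdp => rq.
  by rewrite rq in nrq.
have /Bezout_eq1_coprimepP[[u v] /= /(congr1 (horner_mx A))] := copq.
rewrite rmorphD !rmorphM rmorph1 /= -Ep Cayley_Hamilton mulr0 add0r => E.
by have [] := mulmx1_unit E.
Qed.

(** A relation among [w, C w, ..., C^d w] reads [q(C) w = 0] with [q] nonzero of degree at most [d].
    This is below the degree of [z], so [q(A)] is invertible and [w = 0]. *)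
Lemma krylov_det_neq0 (w : 'cV[int]_d.+1) : w != 0 ->
  \det (\matrix_(i, k < d.+1) (C ^+ k *m w) i 0) != 0.
Proof.
apply: contraNneq => det0.
set K := \matrix_(_, _) _ in det0.
have : \det (map_mx (intr : int -> rat) K)^T = 0 by rewrite det_tr det_map_mx det0.
move/eqP/det0P => [v v0 vK].
have [p [Dp _ dvdp]] := minCpolyP z.
have U : horner_mx A (rVpoly v) \in unitmx.
  apply: horner_mx_unit; rewrite dvdp.
  have sp : size p = d.+2.
    rewrite -(size_char_poly C) -(size_map_poly (ratr : rat -> algC)) -Dp -minC.
    by rewrite (size_map_inj_poly (@intr_inj algC)).
  apply: contra v0 => pv.
  have [/(congr1 (@poly_rV _ d.+1))|nz] := eqVneq (rVpoly v) 0.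
    by rewrite rVpolyK linear0 => ->.
  have := dvdp_leq nz pv; rewrite sp => lt.
  by have := leq_trans lt (size_poly _ _); rewrite ltnn.
have H : horner_mx A (rVpoly v) *m (map_mx intr w) = 0 :> 'cV_ _.
  apply/colP => i; rewrite [RHS]mxE.
  move/matrixP/(_ 0 i): vK => vKi; rewrite !mxE in vKi; rewrite -{}vKi.
  have -> : horner_mx A (rVpoly v) = \sum_(k < d.+1) v 0 k *: A ^+ k.
    rewrite [rVpoly v]poly_def linear_sum; apply: eq_bigr => k _ /=.
    by rewrite valK /= linearZ /= rmorphXn /= horner_mx_X.
  rewrite mulmx_suml summxE; apply: eq_bigr => k _.
  rewrite -scalemxAl AX -map_mxM !mxE; congr (_ * _).
move: H => /(congr1 (mulmx (invmx (horner_mx A (rVpoly v))))).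
rewrite mulKmx // mulmx0 => /matrixP H; apply/eqP/matrixP => i j.
by have := H i j; rewrite !mxE => /eqP; rewrite intr_eq0 => /eqP.
Qed.

(** [C ^+ k - 1] is the value at [C] of ['X^k - 1], which does not vanish at [z]. *)
Lemma pow_mx_neq (k : nat) (w : 'cV[int]_d.+1) :
  z ^+ k != 1 -> w != 0 -> C ^+ k *m w != w.
Proof.
move=> zk; apply: contraNneq => Ckw.
have U : horner_mx A ('X^k - 1) \in unitmx.
  apply: horner_mx_unit; rewrite rmorphB rmorph1 /= map_polyXn.
  by rewrite /root !hornerE subr_eq0.
have : horner_mx A ('X^k - 1) *m map_mx intr w = 0 :> 'cV[rat]_ _.
  rewrite rmorphB rmorph1 /= rmorphXn /= horner_mx_X mulmxBl mul1mx.
  by rewrite AX -map_mxM Ckw subrr.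
move/(congr1 (mulmx (invmx (horner_mx A ('X^k - 1))))).
rewrite mulKmx // mulmx0 => /matrixP H; apply/eqP/matrixP => i j.
by have := H i j; rewrite !mxE => /eqP; rewrite intr_eq0 => /eqP.
Qed.

End Krylov.

(* The symmetric matrices [S k] are the Hankel matrices whose entry (i, j) is
   the coefficient (0, 0) of [C ^+ (i + j + k)]. *)
Lemma cyclotomic_mx_exists (m : nat) : (0 < m)%N ->
  exists (C : 'M[int]_(totient m)) (S : 'I_(totient m) -> 'M[int]_(totient m)),
  [/\ C ^+ m = 1,
      forall k w, (0 < k < m)%N -> w != 0 :> 'cV_ _ -> C^T ^+ k *m w != w,
      forall k, (S k)^T = S k,
      forall k, C *m S k = S k *m C^T
    & forall w : 'cV_(totient m), w != 0 ->
        \det (\matrix_(i, k) (S k *m w) i 0) != 0].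
Proof.
move=> m_gt0; have [z prim_z] := C_prim_root_exists m_gt0.
have [C charC shiftC] := companion_mx_exists (Cyclotomic_monic m)
  (size_Cyclotomic m).
have minC : pZtoC (char_poly C) = minCpoly z.
  by rewrite charC (Cintr_Cyclotomic prim_z) (minCpoly_cyclotomic prim_z).
move: (totient_gt0 m) C charC shiftC minC; rewrite m_gt0.
case: (totient m) => // d _ C charC shiftC minC.
have Cm : C ^+ m = 1.
  have : horner_mx C ('X^m - 1) = 0.
    rewrite -(prod_Cyclotomic m_gt0) (big_rem m) /=; last first.
      by rewrite -dvdn_divisors // dvdnn.
    by rewrite rmorphM /= -charC Cayley_Hamilton mul0r.
  rewrite rmorphB rmorph1 /= rmorphXn /= horner_mx_X.
  by move/eqP; rewrite subr_eq0 => /eqP.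
have rowC (k : 'I_d.+1) :
    (delta_mx 0 0 : 'rV[int]_d.+1) *m C ^+ k = (delta_mx 0 k : 'rV[int]_d.+1).
  case: k => k; elim: k => [|k IHk] lt_k.
    by rewrite expr0 mulmx1; congr delta_mx; apply/val_inj.
  by rewrite exprSr mulmxA (IHk (ltnW lt_k)); apply: shiftC.
have e0 : delta_mx 0 0 != 0 :> 'cV[int]_d.+1.
  by apply/eqP => /matrixP/(_ 0 0); rewrite !mxE.
(* The Krylov matrix of the first basis column. As [C ^+ i] has first row [e_i], the entries of
   [C ^+ k *m S0] depend only on [i + j + k], whence the symmetry. *)
pose S0 : 'M[int]_d.+1 := \matrix_(i, j) (C ^+ j *m (delta_mx 0 0 : 'cV_ _)) i 0.
have S0E k i j : (C ^+ k *m S0) i j = (C ^+ (i + j + k)) 0 0.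
  transitivity (((delta_mx 0 i : 'rV[int]_d.+1) *m
    (C ^+ k *m (C ^+ j *m (delta_mx 0 0 : 'cV[int]_d.+1))) : 'M[int]_1) 0 0).
    rewrite -rowE [RHS]mxE [RHS]mxE [LHS]mxE.
    by apply: eq_bigr => l _; rewrite [S0 _ _]mxE.
  rewrite -(rowC i) !mulmxA -(mulmxA _ (C ^+ i)) -(mulmxA _ (C ^+ i *m _)).
  rewrite -[C ^+ i *m _ *m _]/(C ^+ i * C ^+ k * C ^+ j) -!exprD addnAC.
  by rewrite -rowE -colE !mxE.
have symS k : (C ^+ k *m S0)^T = C ^+ k *m S0.
  by apply/matrixP => i j; rewrite mxE !S0E (addnC j).
exists C, (fun k : 'I_d.+1 => C ^+ k *m S0); split=> //.
- move=> k w /andP[k_gt0 k_lt] w0.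
  apply: (@pow_mx_neq _ C^T z) w0; first by rewrite char_poly_tr.
  rewrite -(prim_order_dvd prim_z); apply/negP => /(dvdn_leq k_gt0).
  by rewrite leqNgt k_lt.
(* [C S_k] is again one of the symmetric matrices, hence equals its transpose [S_k C^T]. *)
- move=> k; have CS : C *m (C ^+ k *m S0) = C ^+ k.+1 *m S0.
    by rewrite mulmxA exprS.
  by rewrite CS -symS -CS trmx_mul symS.
(* The columns [S_k w = C^k (S0 w)] form the Krylov matrix of [S0 w], nonzero because [S0] is itself
   a nonsingular Krylov matrix. *)
- move=> w w0; have S0w : S0 *m w != 0.
    by apply: contra w0 => /eqP /(mulmx_eq0_det (krylov_det_neq0 minC e0)) ->.
  have := krylov_det_neq0 minC S0w; congr (\det _ != 0).
  by apply/matrixP => i k; rewrite [LHS]mxE [RHS]mxE mulmxA.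
Qed.

(** * Principally polarized tori from period matrices *)

Lemma complex_sum (R : pzRingType) (I : Type) (r : seq I) (F G : I -> R) :
  \sum_(i <- r) (F i +i* G i)%C =
  ((\sum_(i <- r) F i) +i* (\sum_(i <- r) G i))%C.
Proof.
elim: r => [|i r IHr]; first by rewrite !big_nil.
by rewrite !big_cons IHr.
Qed.

Section SiegelPpav.
Variables (R : realType) (g : nat) (X Y Z : 'M[R]_g).
Hypotheses (Xsym : X^T = X) (Zpos : posdef Z) (YZ : Y *m Z = 1%:M).

Notation "z %:cR" := (map_mx intr z : 'cV[R]_ _) (at level 2, format "z %:cR").

Definition complexify (a b : 'cV[R]_g) : 'rV[R[i]]_g :=
  \row_j (a j 0 +i* b j 0)%C.

Lemma complexify_surj (x : 'rV[R[i]]_g) : exists a b, x = complexify a b.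
Proof.
exists (\col_j complex.Re (x 0 j)), (\col_j complex.Im (x 0 j)).
by apply/rowP => j; rewrite !mxE; case: (x 0 j).
Qed.

Lemma complexify_inj a b a' b' :
  complexify a b = complexify a' b' -> a = a' /\ b = b'.
Proof.
move=> /rowP E; split; apply/colP => j; have := E j; rewrite !mxE => -[].
  by [].
by [].
Qed.

Lemma dotmx_complexify a b a' b' :
  dotmx (complexify a b) (complexify a' b') =
  ((a^T *m a' + b^T *m b') 0 0 +i* (b^T *m a' - a^T *m b') 0 0)%C.
Proof.
rewrite dotmxE !mxE -big_split /= -sumrB -complex_sum.
by apply: eq_bigr => j _; rewrite !mxE /=; simpc; congr (_ +i* _)%C; ring.
Qed.

(* In the coordinates given by a factor [M] of [Z = M^T M], the Hermitian form
   [z^T Z conj(w)] becomes the standard one. *)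
Variable M : 'M[R]_g.
Hypothesis ZM : Z = M^T *m M.

(* The upper half [u] and the lower half [n] of [c] are the coordinates of the
   lattice vector [u + (X + i Y) n]. *)
Definition period_map (c : 'cV[R]_(g + g)) : 'rV[R[i]]_g :=
  complexify (M *m (usubmx c + X *m dsubmx c)) (M *m Y *m dsubmx c).

Let Munit : M \in unitmx.
Proof.
have [_ ] := mulmx1_unit YZ; rewrite ZM unitmx_mul unitmx_tr.
by case/andP.
Qed.

Let ZY : Z *m Y = 1%:M.
Proof. exact: mulmx1C. Qed.

Let Yunit : Y \in unitmx.
Proof. by have [] := mulmx1_unit YZ. Qed.

Let MYunit : M *m Y \in unitmx.
Proof. by rewrite unitmx_mul Munit. Qed.

Let Ysym : Y^T = Y.
Proof.
rewrite -[LHS]mulmx1 -ZY mulmxA -{1}(proj1 Zpos) -trmx_mul.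
by rewrite ZY trmx1 mul1mx.
Qed.

Let MYM : (M *m Y)^T *m M = 1%:M.
Proof. by rewrite trmx_mul -mulmxA -ZM Ysym. Qed.

(** By the symmetry of [X] and [Y Z = 1], the imaginary part is the standard symplectic form in the
    lattice coordinates, whatever [X] and [Y]. *)
Lemma dot_period_map c d :
  dotmx (period_map c) (period_map d) =
  (((usubmx c + X *m dsubmx c)^T *m Z *m (usubmx d + X *m dsubmx d) +
    (dsubmx c)^T *m Y *m dsubmx d) 0 0 +i*
   ((dsubmx c)^T *m usubmx d - (usubmx c)^T *m dsubmx d) 0 0)%C.
Proof.
have E a b : (M *m Y *m a)^T *m (M *m b) = a^T *m b :> 'M[R]_1.
  by rewrite trmx_mul -mulmxA (mulmxA (M *m Y)^T) MYM mul1mx.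
rewrite dotmx_complexify; congr (_ +i* _)%C.
  apply: (congr1 (fun A : 'M[R]_1 => A 0 0)); congr (_ + _).
    by rewrite trmx_mul ZM !mulmxA.
  by rewrite -(mulmxA M Y (dsubmx d)) E mulmxA.
apply: (congr1 (fun A : 'M[R]_1 => A 0 0)).
rewrite E -[X in _ - X]trmxK trmx_mul trmxK E trmx_mul trmxK.
have -> : (usubmx c + X *m dsubmx c)^T = (usubmx c)^T + (dsubmx c)^T *m X.
  by rewrite linearD /= trmx_mul Xsym.
rewrite mulmxDr mulmxDl mulmxA.
by rewrite opprD addrACA subrr addr0.
Qed.


Let dbl_eq : (2 * g = g + g)%N.
Proof. by rewrite mul2n addnn. Qed.

Definition siegel_periods (j : 'I_(2 * g)) : 'rV[R[i]]_g :=
  period_map (delta_mx (cast_ord dbl_eq j) 0).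

Lemma period_map_sum (I : Type) (r : seq I) (a : I -> R)
    (v : I -> 'cV[R]_(g + g)) :
  period_map (\sum_(i <- r) a i *: v i) =
  \sum_(i <- r) (a i)%:C%C *: period_map (v i).
Proof.
have D c d b : period_map (b *: c + d) = b%:C%C *: period_map c + period_map d.
  rewrite /period_map !linearP /= addrACA -scalerDr linearP /=.
  by apply/rowP => j; rewrite !mxE /=; simpc.
elim: r => [|j r IHr]; last by rewrite !big_cons D IHr.
rewrite !big_nil /period_map !linear0 addr0 mulmx0.
by apply/rowP => j; rewrite !mxE.
Qed.

Lemma sum_siegel_periods (c : 'I_(2 * g) -> R) :
  \sum_j (c j)%:C%C *: siegel_periods j =
  period_map (\col_k c (cast_ord (esym dbl_eq) k)).
Proof.
rewrite -period_map_sum; congr period_map; apply/colP => k.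
rewrite mxE summxE (bigD1 (cast_ord (esym dbl_eq) k)) //= big1.
  by rewrite addr0 !mxE cast_ordKV !eqxx mulr1.
move=> j jk; rewrite !mxE eqxx andbT.
have [E|_] := eqVneq k (cast_ord dbl_eq j); last by rewrite mulr0.
by rewrite E cast_ordK eqxx in jk.
Qed.

Lemma lattice_siegelP x : lattice siegel_periods x <->
  exists z : 'cV[int]_(g + g), x = period_map z%:cR.
Proof.
have E (z : 'I_(2 * g) -> int) : \sum_i siegel_periods i *~ z i =
    period_map (\col_k (z (cast_ord (esym dbl_eq) k))%:~R).
  rewrite -(sum_siegel_periods (fun i => (z i)%:~R)).
  by apply: eq_bigr => i _; rewrite rmorph_int scaler_int.
split=> [[z _ <-]|[z ->]].
  exists (\col_k z (cast_ord (esym dbl_eq) k)); rewrite E; congr period_map.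
  by apply/colP => k; rewrite !mxE.
exists (fun i => z (cast_ord dbl_eq i) 0) => //; rewrite E; congr period_map.
by apply/colP => k; rewrite !mxE cast_ordKV.
Qed.

Lemma period_map_surj x : exists c, x = period_map c.
Proof.
have [a [b ->]] := complexify_surj x.
pose n := invmx (M *m Y) *m b.
exists (col_mx (invmx M *m a - X *m n) n).
by rewrite /period_map col_mxKu col_mxKd subrK mulKVmx // mulKVmx.
Qed.

Lemma period_map_eq0 c : period_map c = 0 -> c = 0.
Proof.
have -> : 0 = complexify 0 0 by apply/rowP => j; rewrite !mxE.
case/complexify_inj => E1 E2.
have dc0 : dsubmx c = 0.
  by rewrite -(mulKmx MYunit (dsubmx c)) E2 mulmx0.
rewrite dc0 mulmx0 addr0 in E1.
by rewrite -[c]vsubmxK dc0 -(mulKmx Munit (usubmx c)) E1 mulmx0 col_mx0.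
Qed.

Lemma siegel_periods_free (c : 'I_(2 * g) -> R) :
  \sum_i (c i)%:C%C *: siegel_periods i = 0 -> forall i, c i = 0.
Proof.
rewrite sum_siegel_periods => /period_map_eq0/colP E i.
by have := E (cast_ord dbl_eq i); rewrite !mxE cast_ordK.
Qed.

Lemma Im_dot_period_map c (z : 'cV[int]_(g + g)) :
  complex.Im (dotmx (period_map c) (period_map z%:cR)) =
  ((dsubmx c)^T *m (usubmx z)%:cR - (usubmx c)^T *m (dsubmx z)%:cR) 0 0.
Proof. by rewrite dot_period_map /= map_usubmx map_dsubmx. Qed.

Lemma siegel_riemann_int x y :
  lattice siegel_periods x -> lattice siegel_periods y ->
  complex.Im (dotmx x y) \is a Num.int.
Proof.
move=> /lattice_siegelP[z ->] /lattice_siegelP[w ->].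
rewrite Im_dot_period_map -map_usubmx -map_dsubmx !map_trmx -!map_mxM -map_mxB.
by rewrite mxE intr_int.
Qed.

(** Pairing with the basis vectors of the lattice reads off each coordinate of [x] up to sign, so
    all of them are integers. *)
Lemma siegel_riemann_principal x :
  (forall y, lattice siegel_periods y -> complex.Im (dotmx x y) \is a Num.int) ->
  lattice siegel_periods x.
Proof.
have [c ->] := period_map_surj x => c_int.
have c_intz z : complex.Im (dotmx (period_map c) (period_map z%:cR)) \is a Num.int.
  by apply/c_int/lattice_siegelP; exists z.
have du k : dsubmx c k 0 \is a Num.int.
  have := c_intz (col_mx (delta_mx k 0) 0).
  rewrite Im_dot_period_map col_mxKu col_mxKd map_mx0 mulmx0 subr0.
  by rewrite map_delta_mx -colE !mxE.
have uu k : usubmx c k 0 \is a Num.int.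
  have := c_intz (col_mx 0 (delta_mx k 0)).
  rewrite Im_dot_period_map col_mxKu col_mxKd map_mx0 mulmx0 sub0r.
  by rewrite map_delta_mx -colE !mxE rpredN.
apply/lattice_siegelP; exists (\col_k Num.floor (c k 0)); congr period_map.
apply/colP => k; rewrite !mxE; apply/esym/eqP; rewrite -intrEfloor.
by case: (splitP k) => j Ej; [have := uu j | have := du j];
  rewrite mxE; congr (c _ _ \is a _); apply/val_inj.
Qed.

Definition siegel_ppav : ppav R g.
Proof.
refine (@Ppav R g 'rV[R[i]]_g _ siegel_periods siegel_periods_free
  (@dotmx R[i] g : {dot 'rV[R[i]]_g for Num.conj})
  siegel_riemann_int siegel_riemann_principal).
by rewrite dimvf /dim /= mul1n.
Defined.

(** The Gram matrix is [P^T diag(Z, Y) P] with [P] unipotent, of determinant [det Z * det Y = 1]. *)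
Lemma siegel_covolume :
  covolume (fun x y => complex.Re (dotmx x y)) siegel_periods = 1.
Proof.
pose P : 'M[R]_(g + g) := block_mx 1%:M X 0 1%:M.
pose G : 'M[R]_(g + g) := P^T *m block_mx Z 0 0 Y *m P.
have detG : \det G = 1.
  rewrite /G !det_mulmx det_tr det_ublock !det1 !mul1r mulr1 det_ublock.
  by rewrite mulrC -det_mulmx YZ det1.
have GE c d : complex.Re (dotmx (period_map c) (period_map d)) =
    (c^T *m G *m d) 0 0.
  rewrite dot_period_map /=; apply: (congr1 (fun A : 'M[R]_1 => A 0 0)).
  have PE v : P *m v = col_mx (usubmx v + X *m dsubmx v) (dsubmx v).
    by rewrite -{1}[v]vsubmxK mul_block_col !mul1mx mul0mx add0r.
  rewrite /G !mulmxA -trmx_mul -(mulmxA _ P) !PE tr_col_mx mul_row_block.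
  by rewrite mul_row_col !mulmx0 addr0 add0r.
rewrite /covolume -[RHS]sqrtr1; congr Num.sqrt; rewrite -detG.
have castG (k : nat) (e : (k = g + g)%N) :
    \det (\matrix_(i < k, j < k) G (cast_ord e i) (cast_ord e j)) = \det G.
  case: (g + g)%N / e G {detG GE} => G'; congr (\det _).
  by apply/matrixP => i j; rewrite !mxE !cast_ord_id.
rewrite -(castG _ dbl_eq); congr (\det _); apply/matrixP => i j.
by rewrite !mxE GE trmx_delta -rowE -colE !mxE.
Qed.

Lemma siegel_injectivity_volume r : (0 < g)%N -> 0 <= r ->
    (forall m n : 'cV[int]_g, ~ (m = 0 /\ n = 0) ->
       r ^+ 2 <= qform Z (m%:cR + X *m n%:cR) + qform Y n%:cR) ->
  unit_ball_volume R (2 * g) * (r / 2) ^+ (2 * g) <= injectivity_volume siegel_ppav.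
Proof.
move=> g_gt0 r0 r_le.
rewrite /injectivity_volume /packing_density.
rewrite (_ : covolume _ _ = 1); last exact: siegel_covolume.
rewrite divr1 ler_wpM2l //; first by rewrite -ball_volume_unit ball_volume_ge0.
set fm := first_minimum _ _.
suff r_fm : r <= fm.
  have fm0 := le_trans r0 r_fm.
  by rewrite lerXn2r ?nnegrE ?divr_ge0 // ler_wpM2r // invr_ge0.
apply: lb_le_inf.
  (* Bounding an infimum from below requires a nonempty set: the all-ones vector is nonzero since
     [g > 0]. *)
  pose z : 'cV[int]_(g + g) := const_mx 1.
  exists (Num.sqrt (complex.Re (dotmx (period_map z%:cR) (period_map z%:cR)))).
  exists (period_map z%:cR) => //; split; first by apply/lattice_siegelP; exists z.
  move=> /period_map_eq0/colP/(_ (lshift g (Ordinal g_gt0))).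
  by rewrite !mxE => /eqP; rewrite oner_eq0.
move=> _ [x [/lattice_siegelP[z ->] z0] <-].
rewrite -[r]ger0_norm // -sqrtr_sqr; apply: ler_wsqrtr.
rewrite [riemann _ _ _]dot_period_map /=.
have := r_le (usubmx z) (dsubmx z); rewrite /qform map_usubmx map_dsubmx.
rewrite [X in _ -> _ <= X]mxE; apply=> -[z1 z2]; apply: z0.
rewrite -[z]vsubmxK z1 z2 col_mx0 map_mx0.
by have := period_map_sum [::] (fun _ : 'I_0 => 0) (fun _ => 0); rewrite !big_nil.
Qed.

End SiegelPpav.

(** * Period matrices without short vectors *)

Lemma dvdn_dist_eq (N x y : nat) :
  (x < N)%N -> (y < N)%N -> (N %| `|x%:Z - y%:Z|)%N -> x = y.
Proof.
move=> xN yN dvd; have [|d0] := posnP `|x%:Z - y%:Z|%N; first by lia.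
by have := dvdn_leq d0 dvd; lia.
Qed.

Section QuadraticForms.
Variable R : realType.

Lemma qformZ n (a : R) (G : 'M[R]_n) x : qform (a *: G) x = a * qform G x.
Proof. by rewrite /qform -scalemxAr -scalemxAl mxE. Qed.

Lemma qformZr n (a : R) (G : 'M[R]_n) x : qform G (a *: x) = a ^+ 2 * qform G x.
Proof.
rewrite /qform (_ : (a *: x)^T = a *: x^T); last by rewrite linearZ.
by rewrite -scalemxAr -!scalemxAl scalerA mxE expr2.
Qed.

Lemma qform_mulmx n (G A : 'M[R]_n) x : qform G (A *m x) = qform (A^T *m G *m A) x.
Proof. by rewrite /qform trmx_mul !mulmxA. Qed.

Lemma qform_block n p (G : 'M[R]_n) (H : 'M[R]_p) x y :
  qform (block_mx G 0 0 H) (col_mx x y) = qform G x + qform H y.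
Proof.
rewrite /qform tr_col_mx mul_row_block mul_row_col !mulmx0 addr0 add0r.
by rewrite [LHS]mxE.
Qed.

Lemma posdef_ge0 n (G : 'M[R]_n) x : posdef G -> 0 <= qform G x.
Proof.
move=> [_ Gpos]; have [->|x0] := eqVneq x 0; last exact/ltW/Gpos.
by rewrite /qform mulmx0 mxE.
Qed.

Lemma posdef_scale n (a : R) (G : 'M[R]_n) : 0 < a -> posdef G -> posdef (a *: G).
Proof.
move=> a0 [Gsym Gpos]; split; first by rewrite linearZ /= Gsym.
by move=> x x0; rewrite qformZ mulr_gt0 // Gpos.
Qed.

Lemma posdef_block n p (G : 'M[R]_n) (H : 'M[R]_p) :
  posdef G -> posdef H -> posdef (block_mx G 0 0 H).
Proof.
move=> Gpos Hpos; split; first by rewrite tr_block_mx !trmx0 Gpos.1 Hpos.1.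
move=> x; rewrite -[x]vsubmxK qform_block => x0.
have [u0|u0] := eqVneq (usubmx x) 0; last first.
  by rewrite ltr_pwDl ?posdef_ge0 // Gpos.2.
rewrite ltr_wpDl ?posdef_ge0 // Hpos.2 //.
by apply: contraNneq x0 => d0; rewrite u0 d0 col_mx0.
Qed.

Lemma posdef_unit n (G : 'M[R]_n) : posdef G -> G \in unitmx.
Proof.
move=> [Gsym Gpos]; rewrite unitmxE unitfE; apply/negP => /det0P[v v0 vG].
have /Gpos : v^T != 0 by rewrite trmx_eq0.
by rewrite /qform trmxK vG mul0mx mxE ltxx.
Qed.

Lemma posdef_inv n (G : 'M[R]_n) : posdef G -> posdef (invmx G).
Proof.
move=> Gpos; have Gunit := posdef_unit Gpos; split.
  by rewrite trmx_inv Gpos.1.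
move=> x x0; rewrite -[x](mulKVmx Gunit) qform_mulmx Gpos.1 mulmxV // mul1mx.
apply: Gpos.2; apply: contraNneq x0 => E.
by rewrite -[x](mulKVmx Gunit) E mulmx0.
Qed.

(** A cube of side [e] fits in the ball: this is the counting bound for the origin alone, with
    [rho = 1/2] and [1/2 + n e <= 1]. *)
Lemma unit_ball_volume_gt0 n : 0 < unit_ball_volume R n.
Proof.
pose e : R := (n%:R + 1)^-1 / 2.
have n0 : 0 < n%:R + 1 :> R by rewrite ltr_wpDl.
have e0 : 0 < e by rewrite divr_gt0 // invr_gt0.
have e2pos : posdef ((e ^+ 2)%:M : 'M[R]_n).
  rewrite -scalemx1; apply: posdef_scale; first exact: exprn_gt0.
  split; first exact: trmx1.
  by move=> x /sqnorm_gt0; rewrite /qform mulmx1 -sqnormE.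
have := @count_posdef R n _ (1 / 2) [:: 0] e2pos isT.
rewrite det_scalar => /(_ _ _ _)/lt_le_trans; apply.
- by rewrite mul1r sqrtr_gt0 exprn_gt0 // exprn_gt0.
- by rewrite divr_ge0.
- move=> z; rewrite inE => /eqP ->.
  by rewrite map_mx0 /qform mulmx0 mxE exprn_gt0 // divr_gt0.
- rewrite (eq_bigr (fun => e)) => [|i _]; last first.
    by rewrite mxE eqxx mulr1n sqrtr_sqr ger0_norm // ltW.
  rewrite sumr_const card_ord -mulr_natr mulrC /e.
  have : n%:R * (n%:R + 1)^-1 <= 1 :> R by rewrite ler_pdivrMr // mul1r lerDl.
  by lra.
Qed.

End QuadraticForms.

(** * Invariant forms of [C] and the counting argument *)

Section Sparse.
Variables (R : realType) (m g : nat) (C : 'M[int]_g) (S : 'I_g -> 'M[int]_g).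
Hypotheses (m_gt0 : (0 < m)%N) (Cm : C ^+ m = 1)
  (C_free : forall k w, (0 < k < m)%N -> w != 0 :> 'cV_g -> C^T ^+ k *m w != w)
  (Ssym : forall k, (S k)^T = S k)
  (CS : forall k, C *m S k = S k *m C^T)
  (S_det : forall w : 'cV_g, w != 0 -> \det (\matrix_(i, k) (S k *m w) i 0) != 0).

Notation "A %:rmx" := (map_mx (intr : int -> R) A) (at level 2, format "A %:rmx").

(** The standard form summed over the powers of [C], which permutes the terms because
    [C ^+ m = 1]. *)
Definition invariant_form : 'M[R]_g :=
  \sum_(k < m) (C ^+ k)%:rmx^T *m (C ^+ k)%:rmx.

Local Notation Z0 := invariant_form.

Lemma qform_Z0 x : qform Z0 x = \sum_(k < m) sqnorm ((C ^+ k)%:rmx *m x).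
Proof.
rewrite /qform /invariant_form mulmx_sumr mulmx_suml summxE.
apply: eq_bigr => k _.
by rewrite sqnormE trmx_mul !mulmxA.
Qed.

Lemma sqnorm_le_qform_Z0 x : sqnorm x <= qform Z0 x.
Proof.
rewrite qform_Z0 (bigD1 (Ordinal m_gt0)) //= expr0 map_mx1 mul1mx.
by rewrite lerDl sumr_ge0 // => k _; apply: sqnorm_ge0.
Qed.

Lemma posdef_Z0 : posdef Z0.
Proof.
split.
  rewrite /invariant_form linear_sum; apply: eq_bigr => k _ /=.
  by rewrite trmx_mul trmxK.
by move=> x /sqnorm_gt0 x0; apply: lt_le_trans (sqnorm_le_qform_Z0 x).
Qed.

Lemma Z0_invariant : C%:rmx^T *m Z0 *m C%:rmx = Z0.
Proof.
have E k : C%:rmx^T *m ((C ^+ k)%:rmx^T *m (C ^+ k)%:rmx) *m C%:rmx =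
    (C ^+ k.+1)%:rmx^T *m (C ^+ k.+1)%:rmx.
  by rewrite exprSr -[C ^+ k * C]/(C ^+ k *m C) map_mxM trmx_mul !mulmxA.
rewrite /invariant_form mulmx_sumr mulmx_suml; under eq_bigr do rewrite E.
case: m m_gt0 Cm => // m' _ Cm'.
by rewrite big_ord_recr big_ord_recl addrC /= Cm'.
Qed.

Local Notation Y0 := (invmx Z0).

Lemma Y0_invariant : C%:rmx *m Y0 *m C%:rmx^T = Y0.
Proof.
have Zu := posdef_unit posdef_Z0.
have E : (C%:rmx^T *m Z0) *m (C%:rmx *m Y0) = 1%:M.
  by rewrite !mulmxA Z0_invariant mulmxV.
have := mulmx1C E; rewrite mulmxA => {}E.
by rewrite -[LHS]mulmx1 -[in LHS](mulmxV Zu) mulmxA E mul1mx.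
Qed.

Lemma qform_Z0_pow k x : qform Z0 ((C ^+ k)%:rmx *m x) = qform Z0 x.
Proof.
elim: k => [|k IHk]; first by rewrite expr0 map_mx1 mul1mx.
rewrite exprS -[C * _]/(C *m _) map_mxM -mulmxA qform_mulmx.
by rewrite Z0_invariant.
Qed.

Lemma qform_Y0_pow k x : qform Y0 ((C^T ^+ k)%:rmx *m x) = qform Y0 x.
Proof.
elim: k => [|k IHk]; first by rewrite expr0 map_mx1 mul1mx.
rewrite exprS -[C^T * _]/(C^T *m _) map_mxM -mulmxA qform_mulmx.
by rewrite -map_trmx trmxK Y0_invariant.
Qed.

Lemma S_pow k j : C ^+ j *m S k = S k *m C^T ^+ j.
Proof.
elim: j => [|j IHj]; first by rewrite !expr0 mulmx1 mul1mx.
by rewrite exprS -mulmxA IHj mulmxA CS -mulmxA exprS.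
Qed.

(* [y = Y0 n] has Euclidean norm at most [qform Y0 n], so [n = Z0 y] is bounded. *)
Lemma qform_Y0_bounded (c : R) : exists b : nat, forall n : 'cV[int]_g,
  qform Y0 n%:rmx < c ^+ 2 -> forall i, (`|n i ord0| <= b)%N.
Proof.
pose B := \sum_i \sum_j `|Z0 i j| * `|c|.
have B0 : 0 <= B by do 2![apply: sumr_ge0 => ? _]; rewrite mulr_ge0.
exists (Num.bound B) => n n_lt i.
pose y := Y0 *m n%:rmx.
have Ey : n%:rmx = Z0 *m y by rewrite mulKVmx // (posdef_unit posdef_Z0).
have yc j : `|y j 0| <= `|c|.
  have yn : qform Z0 y = qform Y0 n%:rmx.
    rewrite /y qform_mulmx (proj1 (posdef_inv posdef_Z0)) mulVmx ?mul1mx //.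
    exact/posdef_unit/posdef_Z0.
  rewrite -ler_sqr ?nnegrE // !real_normK ?num_real //.
  apply: le_trans (ltW n_lt); rewrite -yn; apply: le_trans (sqnorm_le_qform_Z0 y).
  by rewrite /sqnorm (bigD1 j) //= lerDl sumr_ge0 // => k _; apply: sqr_ge0.
rewrite -(ler_nat R) (le_trans _ (ltW (archi_boundP B0))) //.
rewrite natr_absz intr_norm.
have -> : (n i 0)%:~R = (Z0 *m y) i 0 by rewrite -Ey mxE.
rewrite mxE; apply: le_trans (ler_norm_sum _ _ _) _.
apply: (@le_trans _ _ (\sum_j `|Z0 i j| * `|c|)).
  by apply: ler_sum => j _; rewrite normrM ler_wpM2l.
rewrite /B [leRHS](bigD1 i) //= lerDl.
by do 2![apply: sumr_ge0 => ? _]; rewrite mulr_ge0.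
Qed.

Local Notation Sdet v :=
  (\det (\matrix_(i, k) (S k *m v) i 0)).

(** Only finitely many integral [n] are concerned. A prime above [b] is coprime to all their
    determinants, which are nonzero for [n != 0]. *)
Lemma det_bounded (c : R) : exists b : nat, forall n : 'cV[int]_g,
  qform Y0 n%:rmx < c ^+ 2 -> (`|Sdet n| <= b)%N.
Proof.
have [b nb] := qform_Y0_bounded c.
pose vec (f : {ffun 'I_g -> 'I_(2 * b).+1}) : 'cV[int]_g :=
  \col_i ((f i)%:Z - b%:Z).
exists (\max_f `|Sdet (vec f)|)%N => n /nb {}nb.
pose f : {ffun 'I_g -> 'I_(2 * b).+1} := [ffun i => inord `|n i 0 + b%:Z|].
have -> : n = vec f.
  apply/colP => i; have nbi : (`|(n i 0)%R| <= b)%N := nb i.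
  by rewrite mxE ffunE; move: (n i 0) nbi => t tb; rewrite inordK; lia.
exact: (leq_bigmax f).
Qed.


Lemma CT_pow_inj k (x : 'cV[int]_g) : C^T ^+ k *m x = 0 -> x = 0.
Proof.
have CTE j : C^T ^+ j = (C ^+ j)^T.
  elim: j => [|j IHj]; first by rewrite !expr0 trmx1.
  by rewrite exprS exprSr IHj; apply/esym/trmx_mul.
have : (C^T ^+ k) ^+ m = 1 by rewrite exprAC CTE Cm trmx1 expr1n.
case: m m_gt0 => // m' _; rewrite exprSr => E Ex.
have {}E : C^T ^+ k ^+ m' *m C^T ^+ k = 1%:M := E.
by rewrite -[x]mul1mx -E -mulmxA Ex mulmx0.
Qed.

(** The volume hypothesis says that the ball of radius [1 / l] has volume below [m]; the margin
    [1 - l * r] makes room for the cells of the counting bound. *)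
Lemma sparse_period_matrix_exists (r l : R) :
    0 <= r -> 0 < l -> l * r < 1 ->
    unit_ball_volume R (g + g) < m%:R * l ^+ (g + g) ->
  exists X Y Z : 'M[R]_g, [/\ X^T = X, posdef Z, Y *m Z = 1%:M &
    forall u n : 'cV[int]_g, ~ (u = 0 /\ n = 0) ->
      r ^+ 2 <= qform Z (u%:rmx + X *m n%:rmx) + qform Y n%:rmx].
Proof.
move=> r0 l0 lr1 V_lt.
have Y0pos : posdef Y0 := posdef_inv posdef_Z0.
pose sig1 := \sum_i Num.sqrt (Z0 i i); pose sig2 := \sum_i Num.sqrt (Y0 i i).
have sig1_ge0 : 0 <= sig1 by apply: sumr_ge0 => i _; apply: sqrtr_ge0.
have sig2_ge0 : 0 <= sig2 by apply: sumr_ge0 => i _; apply: sqrtr_ge0.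
(* Half of the margin goes to the cells of each diagonal block. The scale [s] is small enough for
   the [Y] block and for [r <= 1 / s], which excludes short vectors with [n = 0]. *)
pose e := (1 - l * r) / 2; have e0 : 0 < e by rewrite divr_gt0 // subr_gt0.
pose s := Num.min (e / (l * (sig2 + 1))) (r + 1)^-1.
have sig2_gt0 : 0 < l * (sig2 + 1) by rewrite mulr_gt0 // ltr_wpDl.
have r1_gt0 : 0 < r + 1 by rewrite ltr_wpDl.
have s0 : 0 < s.
  by rewrite lt_min; apply/andP; split; [apply: divr_gt0|rewrite invr_gt0].
have s_sig2 : l * s * sig2 <= e.
  have : s <= e / (l * (sig2 + 1)) by rewrite ge_min lexx.
  rewrite ler_pdivlMr // => sle.
  have : 0 <= l * s by rewrite mulr_ge0 // ltW.
  by lra.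
have sr : s * r <= 1.
  have : s <= (r + 1)^-1 by rewrite ge_min lexx orbT.
  rewrite -[_^-1]mul1r ler_pdivlMr // => sle.
  by lra.
have r2_le : r ^+ 2 <= s ^- 2.
  rewrite -[s ^- 2]mul1r ler_pdivlMr ?exprn_gt0 // -exprMn mulrC.
  by rewrite expr_le1 // mulr_ge0 // ltW.
have [b bP] := det_bounded (r / s).
(* [N >= K] keeps the cells of the [Z] block within [e]; [N > b] makes the determinants invertible
   modulo [N]. *)
pose K := l * sig1 / (s * e).
have K0 : 0 <= K by rewrite divr_ge0 // mulr_ge0 // ltW.
have [N N_gt N_prime] := prime_above (maxn b (Num.bound K)).
have b_lt : (b < N)%N by apply: leq_ltn_trans N_gt; apply: leq_maxl.
have N0 : 0 < N%:R :> R by rewrite ltr0n prime_gt0.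
have N_sig1 : l * (s * N%:R)^-1 * sig1 <= e.
  have : K <= N%:R.
    apply: le_trans (ltW (archi_boundP K0)) _; rewrite ler_nat.
    by apply: leq_trans (ltnW N_gt); apply: leq_maxr.
  have se0 : 0 < s * e by apply: mulr_gt0.
  have sN0 : 0 < s * N%:R by apply: mulr_gt0.
  by rewrite ler_pdivrMr // => Kle; rewrite mulrAC ler_pdivrMr //; lra.
have posZ : posdef (s ^- 2 *: Z0).
  by apply: posdef_scale posdef_Z0; rewrite invr_gt0 exprn_gt0.
have posY : posdef (s ^+ 2 *: Y0) by apply: posdef_scale; rewrite ?exprn_gt0.
have YZ : (s ^+ 2 *: Y0) *m (s ^- 2 *: Z0) = 1%:M.
  rewrite -scalemxAr -scalemxAl scalerA mulVf ?expf_neq0 ?lt0r_neq0 //.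
  by rewrite scale1r mulVmx // posdef_unit //; apply: posdef_Z0.
apply: contrapT => no_X.
(* [XN a] is the integral matrix [N X]. *)
pose XN (a : {ffun 'I_g -> 'I_N}) : 'M[int]_g := \sum_k (a k)%:Z *: S k.
pose X a : 'M[R]_g := N%:R^-1 *: (XN a)%:rmx.
have Xsym a : (X a)^T = X a.
  rewrite /X linearZ /= map_trmx; congr (_ *: map_mx _ _).
  by rewrite /XN linear_sum; apply: eq_bigr => k _; rewrite linearZ /= Ssym.
have /choice[un unP] (a : {ffun 'I_g -> 'I_N}) :
    exists un : 'cV[int]_g * 'cV[int]_g, ~ (un.1 = 0 /\ un.2 = 0) /\
    qform (s ^- 2 *: Z0) (un.1%:rmx + X a *m un.2%:rmx) +
      qform (s ^+ 2 *: Y0) un.2%:rmx < r ^+ 2.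
  apply: contrapT => no_un; apply: no_X; exists (X a), (s ^+ 2 *: Y0), (s ^- 2 *: Z0).
  split=> // u n un0.
  by rewrite leNgt; apply/negP => lt; apply: no_un; exists (u, n).
(* If [n = 0], then [u] is integral and nonzero, so the squared length is at least
   [s ^- 2 >= r ^+ 2]. *)
have n_neq0 a : (un a).2 != 0.
  have [un0 lt] := unP a; apply/eqP => n0.
  rewrite n0 map_mx0 mulmx0 addr0 {2}/qform mulmx0 mxE addr0 in lt.
  have u0 : (un a).1 != 0 by apply/eqP => u0; apply: un0.
  have : 1 <= qform Z0 (un a).1%:rmx.
    apply: le_trans (sqnorm_le_qform_Z0 _).
    have -> : sqnorm (un a).1%:rmx = (sqnorm (un a).1)%:~R.
      by rewrite /sqnorm rmorph_sum; apply: eq_bigr => i _; rewrite mxE rmorphXn.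
    by rewrite -[1]/(1%:~R) ler_int -gtz0_ge1 sqnorm_gt0.
  move=> le1; move: lt; rewrite qformZ ltNge => /negP; apply.
  by apply: le_trans r2_le _; rewrite ler_peMr // invr_ge0 exprn_ge0 // ltW.
pose nu a k := C^T ^+ k *m (un a).2.
(* This is [(N (u' + X n'), n')] for the image [(u', n')] of the short vector of [a] under the
   [k]-th power of the isometry. *)
pose pt (ak : {ffun 'I_g -> 'I_N} * 'I_m) : 'cV[int]_(g + g) :=
  col_mx (N%:Z *: (C ^+ ak.2 *m (un ak.1).1) + XN ak.1 *m nu ak.1 ak.2)
         (nu ak.1 ak.2).
have nu_neq0 a k : nu a k != 0.
  by apply: contraNneq (n_neq0 a) => /CT_pow_inj ->.
have nu_det a k : (`|Sdet (nu a k)| < N)%N.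
  apply: leq_ltn_trans (bP _ _) b_lt.
  rewrite /nu map_mxM qform_Y0_pow exprMn exprVn.
  rewrite ltr_pdivlMr ?exprn_gt0 // mulrC -qformZ.
  by apply: le_lt_trans (unP a).2; rewrite lerDr posdef_ge0.
have XN_mul a v : XN a *m v =
    (\matrix_(i, k) (S k *m v) i 0) *m (\col_k (a k)%:Z).
  apply/colP => i; rewrite /XN mulmx_suml summxE [RHS]mxE; apply: eq_bigr => k _.
  by rewrite -scalemxAl !mxE mulrC.
(* Equal lower halves give a common [v]; the upper halves modulo [N] then give [M a = M a'] with
   [det M] prime to [N], so [a = a']. Finally [k = k'] because the powers of [C^T] act freely on
   nonzero vectors. *)
have pt_inj : injective pt.
  move=> [a k] [a' k'] /eq_col_mx[/= E1 E2].
  have Ea : a = a'.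
    move: E1; rewrite -E2 !XN_mul; set v := nu a k; set M := \matrix_(_, _) _.
    move=> E1.
    have {}E1 : M *m (\col_k (a k)%:Z - \col_k (a' k)%:Z) =
        N%:Z *: (C ^+ k' *m (un a').1 - C ^+ k *m (un a).1).
      rewrite mulmxBr scalerBr; apply/eqP; rewrite subr_eq addrAC -E1.
      by rewrite addrAC subrr add0r.
    have {}E1 := congr1 (mulmx (\adj M)) E1.
    rewrite mulmxA mul_adj_mx mul_scalar_mx -scalemxAr in E1.
    apply/ffunP => j; apply/val_inj.
    have := congr1 (fun x : 'cV_g => x j 0) E1; rewrite !mxE => {}E1.
    have : (N %| `|Sdet v| * `|(a j)%:Z - (a' j)%:Z|)%N.
      by rewrite -abszM E1 abszM dvdn_mulr.
    rewrite Gauss_dvdr; last first.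
      rewrite prime_coprime //; apply/negP => /dvdn_leq.
      rewrite absz_gt0 S_det ?nu_neq0 // => /(_ isT).
      by rewrite leqNgt nu_det.
    exact: dvdn_dist_eq (ltn_ord _) (ltn_ord _).
  move: E2; rewrite -{}Ea => {a' E1} E2; congr (_, _); apply/val_inj => /=.
  wlog kk : k k' E2 / (k <= k')%N.
    by move=> W; case: (leqP k k') => [|/ltnW] kk; [apply: W|apply/esym/W].
  apply/eqP; rewrite eqn_leq kk /= leqNgt; apply/negP => lt_k.
  have : C^T ^+ k *m (C^T ^+ (k' - k) *m (un a).2 - (un a).2) = 0.
    rewrite mulmxBr mulmxA -[_ *m C^T ^+ (k' - k)]/(C^T ^+ k * C^T ^+ (k' - k)).
    by rewrite -exprD subnKC // -[X in X - _]/(nu a k') -E2 subrr.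
  move=> /CT_pow_inj/eqP; rewrite subr_eq0; apply/negP/C_free => //.
  by rewrite subn_gt0 lt_k (leq_ltn_trans (leq_subr _ _)).
(* At [pt (a, k)] this form is [l ^+ 2] times the squared length of the short vector of [a]. In its
   determinant the powers of [s] and [det Z0] cancel. *)
pose G : 'M[R]_(g + g) :=
  l ^+ 2 *: block_mx ((s * N%:R) ^- 2 *: Z0) 0 0 (s ^+ 2 *: Y0).
have sN0 : 0 < s * N%:R by apply: mulr_gt0.
have Gpos : posdef G.
  apply: posdef_scale; first exact: exprn_gt0.
  apply: posdef_block => //; apply: posdef_scale posdef_Z0.
  by rewrite invr_gt0 exprn_gt0.
have detG : Num.sqrt (\det G) = l ^+ (g + g) / N%:R ^+ g.
  have detZ0 : \det Z0 != 0.
    by have := posdef_unit posdef_Z0; rewrite unitmxE unitfE.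
  have -> : \det G = (l ^+ (g + g) / N%:R ^+ g) ^+ 2.
    rewrite /G detZ det_ublock !detZ det_inv.
    rewrite [(_ ^- 2) ^+ g]exprVn (exprAC (s * _) 2 g).
    rewrite (exprAC l 2 (g + g)) (exprAC s 2 g) (exprMn g s).
    have : s ^+ g != 0 by rewrite expf_neq0 // lt0r_neq0.
    have : N%:R ^+ g != 0 :> R by rewrite expf_neq0 // lt0r_neq0.
    move: (\det Z0) (s ^+ g) (N%:R ^+ g) (l ^+ (g + g)) detZ0 => d S' N' L.
    by move=> d0 N'0 S'0; field; rewrite d0 N'0 S'0.
  by rewrite sqrtr_sqr ger0_norm // divr_ge0 // exprn_ge0 // ltW.
have qformG ak : qform G (pt ak)%:rmx < (l * r) ^+ 2.
  case: ak => a k; rewrite /G qformZ [ltRHS]exprMn ltr_pM2l ?exprn_gt0 //.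
  rewrite /pt /= map_col_mx qform_block.
  have -> : (N%:Z *: (C ^+ k *m (un a).1) + XN a *m nu a k)%:rmx =
      N%:R *: ((C ^+ k)%:rmx *m ((un a).1%:rmx + X a *m (un a).2%:rmx)).
    rewrite map_mxD map_mxZ !map_mxM mulmxDr scalerDr; congr (_ + _).
    rewrite /X -scalemxAl -scalemxAr scalerA mulfV ?lt0r_neq0 // scale1r.
    rewrite -!map_mxM /nu !mulmxA; congr (map_mx _ (_ *m _)).
    rewrite /XN mulmx_suml mulmx_sumr; apply: eq_bigr => i _.
    by rewrite -scalemxAl -scalemxAr S_pow.
  rewrite qformZ qformZr qform_Z0_pow qformZ /nu map_mxM qform_Y0_pow.
  have := (unP a).2; rewrite !qformZ.
  have sNE q : (s * N%:R) ^- 2 * (N%:R ^+ 2 * q) = s ^- 2 * q.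
    by rewrite mulrA exprMn invfM mulfVK // expf_neq0 // lt0r_neq0.
  by rewrite sNE.
have := count_posdef (rho := l * r) (s := map pt (enum predT)) Gpos _ _ _ _.
rewrite map_inj_uniq // enum_uniq size_map -cardE card_prod card_ffun !card_ord.
rewrite detG => H.
have {H} : m%:R * l ^+ (g + g) <= unit_ball_volume R (g + g).
  apply: le_trans (H isT _ _ _).
  - have : N%:R ^+ g != 0 :> R by rewrite expf_neq0 // lt0r_neq0.
    rewrite natrM natrX; move: (N%:R ^+ g) => N' N'0.
    by rewrite le_eqVlt; apply/orP; left; apply/eqP; field.
  - by rewrite mulr_ge0 // ltW.
  - by move=> _ /mapP[ak _ ->]; apply: qformG.
  (* Each block contributes at most [e], and [l * r + 2 * e = 1]. *)
  rewrite big_split_ord /=.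
  have -> : \sum_(i < g) Num.sqrt (G (lshift g i) (lshift g i)) =
      l * (s * N%:R)^-1 * sig1.
    rewrite mulr_sumr; apply: eq_bigr => i _; rewrite mxE block_mxEul mxE mulrA.
    rewrite -exprVn -exprMn sqrtrM ?sqr_ge0 // sqrtr_sqr ger0_norm //.
    by rewrite mulr_ge0 ?invr_ge0 // ltW.
  have -> : \sum_(i < g) Num.sqrt (G (rshift g i) (rshift g i)) = l * s * sig2.
    rewrite mulr_sumr; apply: eq_bigr => i _; rewrite mxE block_mxEdr mxE mulrA.
    rewrite -exprMn sqrtrM ?sqr_ge0 // sqrtr_sqr ger0_norm //.
    by rewrite mulr_ge0 // ltW.
  by move: N_sig1 s_sig2; rewrite /e; lra.
by rewrite leNgt V_lt.
Qed.

End Sparse.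

(** * Choice of the radius and passage to the supremum *)

Lemma root_exists (R : realType) (n : nat) (x : R) :
  (0 < n)%N -> 0 < x -> exists2 r, 0 < r & r ^+ n = x.
Proof.
move=> n0 x0; exists (x `^ n%:R^-1); first exact: powR_gt0.
rewrite -powR_mulrn ?powR_ge0 // -powRrM mulVf ?powRr1 ?ltW //.
by rewrite pnatr_eq0 -lt0n.
Qed.

Lemma ppav_of_density (R : realType) (m : nat) (v : R) :
    (3 <= m)%N -> 0 < v < m%:R ->
  exists A : ppav R (totient m),
    v / 4 ^+ totient m <= injectivity_volume A.
Proof.
move=> m3 /andP[v0 vm]; have m_gt0 : (0 < m)%N by apply: leq_trans m3.
have [C [S [Cm C_free Ssym CS S_det]]] := cyclotomic_mx_exists m_gt0.
set g := totient m in C S Cm C_free Ssym CS S_det *.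
have g_gt0 : (0 < g)%N by rewrite totient_gt0.
have gg_gt0 : (0 < g + g)%N by rewrite addn_gt0 g_gt0.
set V := unit_ball_volume R (g + g).
have V0 : 0 < V := unit_ball_volume_gt0 R (g + g).
have [r r0 rE] := root_exists gg_gt0 (divr_gt0 v0 V0).
(* With [r] and [t] the radii of the balls of volumes [v] and [w], the scale [l = 1 / t] satisfies
   [l r < 1] because [v < w], and the volume hypothesis because [w < m]. *)
pose w := (v + m%:R) / 2.
have vw : v < w by rewrite /w; lra.
have wm : w < m%:R by rewrite /w; lra.
have w0 : 0 < w := lt_trans v0 vw.
have [t t0 tE] := root_exists gg_gt0 (divr_gt0 w0 V0).
have rt : r < t.
  by rewrite -(ltr_pXn2r gg_gt0) ?nnegrE ?ltW // rE tE ltr_pM2r // invr_gt0.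
have V_lt : V < m%:R * t^-1 ^+ (g + g).
  rewrite exprVn tE invf_div mulrA ltr_pdivlMr // mulrC ltr_pM2r //.
have tr : t^-1 * r < 1 by rewrite mulrC ltr_pdivrMr // mul1r.
have ti0 : 0 < t^-1 by rewrite invr_gt0.
have [X [Y [Z [Xsym Zpos YZ sparse]]]] := sparse_period_matrix_exists m_gt0
  Cm C_free Ssym CS S_det (ltW r0) ti0 tr V_lt.
have [M [_ _ ZM]] := cholesky Zpos.
exists (siegel_ppav Xsym Zpos YZ ZM).
apply: le_trans (siegel_injectivity_volume Xsym Zpos YZ ZM g_gt0 (ltW r0) sparse).
rewrite mul2n -addnn expr_div_n rE mulrA mulrCA -/V divff ?lt0r_neq0 // mulr1.
have E : 2 ^+ 2 = 4 :> R by ring.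
by rewrite addnn -mul2n exprM E.
Qed.

Theorem mainTheorem1 (R : realType) (m : nat) (hm : (3 <= m)%N) :
  let g := totient m in
  ((m%:R / 4 ^+ g)%:E <= sup_injectivity_volume R g)%E.
Proof.
cbv zeta; set g := totient m.
apply/lee_addgt0Pr => e e0.
have m0 : 0 < m%:R :> R by rewrite ltr0n (leq_trans _ hm).
(* The bound by [m / 2] keeps [m - d] positive; dividing by [4 ^+ g >= 1] leaves an error of at most
   [e]. *)
pose d := Num.min e (m%:R / 2).
have d0 : 0 < d by rewrite lt_min e0 divr_gt0.
have d_lt : d < m%:R.
  by rewrite gt_min; apply/orP; right; lra.
have [|A vA] := @ppav_of_density R m (m%:R - d) hm.
  by rewrite subr_gt0 d_lt gtrBl d0.
apply: (@le_trans _ _ ((injectivity_volume A)%:E + e%:E)%E); last first.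
  by rewrite leeD2r //; apply: ereal_sup_ubound; exists A.
rewrite -EFinD lee_fin -lerBlDr; apply: le_trans vA.
rewrite mulrBl lerD2l lerN2 ler_pdivrMr ?exprn_gt0 //.
apply: (@le_trans _ _ e); first by rewrite ge_min lexx.
by rewrite ler_peMr ?(ltW e0) // exprn_ege1 // ler1n.
Qed.
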